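(* Let $m$ be a nonnegative integer, and let $\alpha$ be a complex number. Then $$(-1)^{m+1}\frac{\alpha^{2m+1}-(\alpha-1)^{2m+1}}{4}\cdot\frac{\pi^{2m+2}}{(2m+1)!}+\sum_{k=0}^m(-1)^k\left(\alpha^{2k}+(\alpha-1)^{2k}\right)\frac{\pi^{2k}}{(2k)!}\,\lambda(2m-2k+2)=0,$$ where $0^0=1$.
   Context: The Dirichlet lambda function is $\lambda(s)=\sum_{n=0}^\infty\frac{1}{(2n+1)^s}$ for $\mathrm{Re}(s)>1$. *)

(* Defs.v *)
From Stdlib Require Import Reals Factorial.
From Coquelicot Require Import Coquelicot.
Open Scope C_scope.

Definition Cexp (z : C) : C :=
  ((exp (Re z) * cos (Im z))%R, (exp (Re z) * sin (Im z))%R).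

(* x ^ s for a real base x > 0 and a complex exponent s (principal branch);
   outside x > 0 the value is not meaningful, since [ln x] is not. *)
Definition RCpow (x : R) (s : C) : C := Cexp (s * RtoC (ln x)).

(* Coquelicot's [Series] is real-valued only. This is its complex analogue, a
   total function picking the sum of [a] whenever [a] is summable. *)
Definition CSeries (a : nat -> C) : C :=
  @iota C_CompleteNormedModule
    (@is_series C_AbsRing C_NormedModule a).

Lemma CSeries_unique (a : nat -> C) (l : C) :
  @is_series C_AbsRing C_NormedModule a l -> CSeries a = l.
Proof.
exact (@iota_filterlim_locally C_AbsRing C_CompleteNormedModule nat
         eventually _ (sum_n a) l).
Qed.

(* The series converges for 1 < Re s; other values of s are irrelevant. *)
Definition dirichlet_lambda (s : C) : C :=
  CSeries (fun n : nat => 1 / RCpow (INR (2 * n + 1)) s).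

(* Main.v *)
Require Import Defs.
From Stdlib Require Import Reals Factorial Lra Lia.
From Coquelicot Require Import Coquelicot.

(** The identity is a quadrature rule for polynomials, read through the cosine
series with odd frequencies.

For a smooth real function [q], write c_n(q) for the integral of
[q t * cos ((2 n + 1) t)] over the interval from 0 to pi/2.

- Summation over n. The Dirichlet kernel cos t + cos 3t + ... concentrates at 0
  and gives: if the series of the c_n(q) converges, its sum is (pi/4) q(0)
  ([odd_cos_series]). The claim is explicit for [cos] and [sin]. Subtracting
  q(0) cos t + q'(0) sin t reduces it to a function that is O(sin^2 t). The
  Cesaro means of the partial sums of the kernel are
  sin ((M+1) t) sin ((M+2) t) / (2 (M+1) sin^2 t), so against such a function
  they integrate to O(1/M), and the sum must be 0 ([odd_cos_series_zero]).

- Value of each coefficient. If q is a polynomial of degree 2m+1 which, with all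
  its derivatives of even order, vanishes at pi/2, repeated integration by parts
  leaves boundary terms only at 0. It writes c_n(q) as a combination of the
  powers (2n+1)^-2, ..., (2n+1)^-(2m+2), whose coefficients are up to sign the
  derivatives of odd order of q at 0 ([odd_cos_coef_tower]). Summing over n turns
  these powers into lambda(2), ..., lambda(2m+2).

Equating both values yields a linear relation between pi, the derivatives of q at
0 and the numbers lambda(2j) ([tower_lambda_even]). The theorem is this relation
for the real and imaginary parts of
q(t) = ((t + b)^(2m+1) + (t - b - pi)^(2m+1)) / (2m+1)!  with b = (alpha - 1) pi,
which is odd about pi/2 and has q(0) proportional to
(alpha - 1)^(2m+1) - alpha^(2m+1). *)

Open Scope R_scope.

(** * The kernel of odd cosines *)

Definition odd_cos_coef (f : R -> R) (n : nat) : R :=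
  RInt (fun t => f t * cos (INR (2 * n + 1) * t)) 0 (PI / 2).

Lemma INR_odd (n : nat) : INR (2 * n + 1) = 2 * INR n + 1.
Proof. rewrite plus_INR, mult_INR; simpl; ring. Qed.

Lemma sum_n_S (a : nat -> R) (n : nat) : sum_n a (S n) = sum_n a n + a (S n).
Proof. exact (sum_Sn a n). Qed.

Lemma sum_odd_cos (t : R) (N : nat) :
  2 * sin t * sum_n (fun n => cos (INR (2 * n + 1) * t)) N
  = sin (INR (2 * (N + 1)) * t).
Proof.
induction N as [|N IH].
- rewrite sum_O; simpl.
  replace ((1 + 1) * t) with (2 * t) by ring.
  rewrite Rmult_1_l, sin_2a; ring.
- rewrite sum_n_S, Rmult_plus_distr_l, IH.
  rewrite INR_odd, !mult_INR, !plus_INR, !(S_INR N); simpl (INR 1); simpl (INR 2).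
  replace ((1 + 1) * (INR N + 1) * t) with ((2 * (INR N + 1) + 1) * t - t) by ring.
  replace ((1 + 1) * (INR N + 1 + 1) * t) with ((2 * (INR N + 1) + 1) * t + t) by ring.
  rewrite sin_minus, sin_plus; ring.
Qed.

(** The unnormalised Fejer kernel of the odd frequencies: summing once more over
the partial sums makes the quotient by sin^2 bounded uniformly in [M], which
allows an estimate that involves no derivative of the test function. *)
Lemma double_sum_odd_cos (t : R) (M : nat) :
  2 * sin t ^ 2 * sum_n (sum_n (fun n => cos (INR (2 * n + 1) * t))) M
  = sin (INR (M + 1) * t) * sin (INR (M + 2) * t).
Proof.
induction M as [|M IH].
- rewrite !sum_O; simpl.
  replace ((1 + 1) * t) with (2 * t) by ring.
  rewrite !Rmult_1_l, sin_2a; ring.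
- rewrite sum_n_S, Rmult_plus_distr_l, IH.
  replace (2 * sin t ^ 2 * sum_n (fun n => cos (INR (2 * n + 1) * t)) (S M))
    with (sin t * (2 * sin t * sum_n (fun n => cos (INR (2 * n + 1) * t)) (S M)))
    by ring.
  rewrite sum_odd_cos, mult_INR, !plus_INR, !(S_INR M); simpl (INR 1); simpl (INR 2).
  set (x := (INR M + (1 + 1)) * t).
  replace ((INR M + 1) * t) with (x - t) by (unfold x; ring).
  replace ((1 + 1) * (INR M + 1 + 1) * t) with (2 * x) by (unfold x; ring).
  replace ((INR M + 1 + 1) * t) with x by (unfold x; ring).
  replace ((INR M + 1 + (1 + 1)) * t) with (x + t) by (unfold x; ring).
  rewrite sin_2a, sin_minus, sin_plus; ring.
Qed.

(** A crude form of Jordan's inequality, read off the cubic Taylor bound. *)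
Lemma sin_ge_third (t : R) : 0 <= t <= PI / 2 -> t / 3 <= sin t.
Proof.
intros [H0 H1].
pose proof PI_4.
destruct (pre_sin_bound t 0) as [H2 _]; try lra.
unfold sin_approx, sin_term in H2; simpl in H2.
nra.
Qed.

Lemma sum_RInt (f : nat -> R -> R) (a b : R) (N : nat) :
  (forall n t, continuous (f n) t) ->
  sum_n (fun n => RInt (f n) a b) N = RInt (fun t => sum_n (fun n => f n t) N) a b.
Proof.
intros Hf; symmetry; apply is_RInt_unique.
induction N as [|N IH].
- rewrite sum_O.
  apply (is_RInt_ext (f 0%nat)); [intros; now rewrite sum_O|].
  apply @RInt_correct, @ex_RInt_continuous; auto.
- rewrite sum_Sn.
  apply (is_RInt_ext (fun t => plus (sum_n (fun n => f n t) N) (f (S N) t)));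
    [intros; now rewrite sum_Sn|].
  apply @is_RInt_plus; auto.
  apply @RInt_correct, @ex_RInt_continuous; auto.
Qed.

Lemma continuous_sum_n (f : nat -> R -> R) (N : nat) (t : R) :
  (forall n, continuous (f n) t) -> continuous (fun t => sum_n (fun n => f n t) N) t.
Proof.
intros Hf; induction N as [|N IH].
- apply (continuous_ext (f 0%nat)); auto; intros; now rewrite sum_O.
- apply (continuous_ext (fun t => plus (sum_n (fun n => f n t) N) (f (S N) t)));
    [intros; now rewrite sum_Sn|].
  now apply @continuous_plus.
Qed.

Lemma continuous_cos_lin (a t : R) : continuous (fun t => cos (a * t)) t.
Proof. apply (ex_derive_continuous (fun t => cos (a * t))). auto_derive; auto. Qed.

Lemma continuous_mult_cos (f : R -> R) (a t : R) :
  continuous f t -> continuous (fun t => f t * cos (a * t)) t.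
Proof. intros; apply @continuous_mult; auto using continuous_cos_lin. Qed.

(** The factor sin^2 in the bound on [h] cancels the denominator of the Fejer
kernel, so the partial sums of the series, added up, stay bounded. Hence their
Cesaro means tend to 0; they also tend to [l]. *)
Lemma odd_cos_series_zero (h : R -> R) (K l : R) :
  (forall t, continuous h t) ->
  (forall t, 0 <= t <= PI / 2 -> Rabs (h t) <= K * sin t ^ 2) ->
  is_series (odd_cos_coef h) l -> l = 0.
Proof.
intros Hc HK Hl.
assert (HPI := PI_RGT_0).
set (u := sum_n (odd_cos_coef h)).
assert (Hu : is_lim_seq (fun n => sum_f_R0 u (pred n) / INR n) l).
{ apply is_lim_seq_Reals, Cesaro_1, is_lim_seq_Reals; exact Hl. }
assert (HK0 : 0 <= K).
{ specialize (HK (PI / 2)); rewrite sin_PI2 in HK.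
  pose proof (Rabs_pos (h (PI / 2))); lra. }
set (D := PI / 2 * (K / 2)).
assert (HD : 0 <= D) by (unfold D; nra).
assert (Hb : forall M, Rabs (sum_f_R0 u M) <= D).
{ intros M; rewrite <- sum_n_Reals; unfold u.
  assert (E : sum_n (sum_n (odd_cos_coef h)) M
    = RInt (fun t => h t * sum_n (sum_n (fun n => cos (INR (2 * n + 1) * t))) M)
        0 (PI / 2)).
  { rewrite (sum_n_ext _ (fun N => RInt (fun t =>
       sum_n (fun n => h t * cos (INR (2 * n + 1) * t)) N) 0 (PI / 2))).
    - rewrite sum_RInt.
      + apply RInt_ext; intros t _.
        rewrite <- (sum_n_mult_l (K := R_Ring)); apply sum_n_ext; intros N.
        apply (sum_n_mult_l (K := R_Ring)).
      + intros N t; apply (continuous_sum_n (fun n t => h t * cos (INR (2 * n + 1) * t))).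
        intros n; now apply continuous_mult_cos.
    - intros N; apply sum_RInt; intros n t; now apply continuous_mult_cos. }
  rewrite E; unfold D; replace (PI / 2 * (K / 2)) with ((PI / 2 - 0) * (K / 2)) by ring.
  apply abs_RInt_le_const; [lra| |].
  - apply @ex_RInt_continuous; intros t _.
    apply @continuous_mult; auto.
    apply (continuous_sum_n (fun N t => sum_n (fun n => cos (INR (2 * n + 1) * t)) N)).
    intros N; apply (continuous_sum_n (fun n t => cos (INR (2 * n + 1) * t))).
    intros; apply continuous_cos_lin.
  - intros t Ht; rewrite Rabs_mult.
    set (s := sum_n _ M).
    assert (Hs : sin t ^ 2 * Rabs s <= / 2).
    { assert (H := double_sum_odd_cos t M); fold s in H.
      assert (H' : Rabs (2 * sin t ^ 2 * s) <= 1).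
      { rewrite H, Rabs_mult.
        assert (Hx : forall x, Rabs (sin x) <= 1)
          by (intros x; apply Rabs_le; pose proof (SIN_bound x); lra).
        pose proof (Hx (INR (M + 1) * t)); pose proof (Hx (INR (M + 2) * t)).
        pose proof (Rabs_pos (sin (INR (M + 1) * t))).
        pose proof (Rabs_pos (sin (INR (M + 2) * t))). nra. }
      rewrite !Rabs_mult, (Rabs_pos_eq 2), (Rabs_pos_eq (sin t ^ 2)) in H';
        [lra|apply pow2_ge_0|lra]. }
    pose proof (HK t Ht); pose proof (Rabs_pos s).
    apply Rle_trans with (K * sin t ^ 2 * Rabs s); [|nra].
    now apply Rmult_le_compat_r. }
assert (H0 : is_lim_seq (fun n => sum_f_R0 u (pred n) / INR n) 0).
{ apply is_lim_seq_le_le_loc with (u := fun n => - D * / INR n) (w := fun n => D * / INR n).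
  - exists 1%nat; intros n Hn; specialize (Hb (pred n)); apply Rabs_le_between in Hb.
    assert (0 < / INR n) by (apply Rinv_0_lt_compat, lt_0_INR; lia).
    unfold Rdiv; nra.
  - replace (Finite 0) with (Rbar_mult (- D) 0) by (simpl; f_equal; ring).
    apply is_lim_seq_scal_l.
    replace (Finite 0) with (Rbar_inv p_infty) by reflexivity.
    apply is_lim_seq_inv; [apply is_lim_seq_INR|discriminate].
  - replace (Finite 0) with (Rbar_mult D 0) by (simpl; f_equal; ring).
    apply is_lim_seq_scal_l.
    replace (Finite 0) with (Rbar_inv p_infty) by reflexivity.
    apply is_lim_seq_inv; [apply is_lim_seq_INR|discriminate]. }
apply is_lim_seq_unique in Hu; apply is_lim_seq_unique in H0.
rewrite Hu in H0; now injection H0.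
Qed.

(** * The sum of the odd cosine coefficients *)

Lemma sin_INR_PI (n : nat) : sin (INR n * PI) = 0.
Proof.
apply sin_eq_0_1; exists (Z.of_nat n); now rewrite INR_IZR_INZ.
Qed.

Lemma odd_cos_coef_cos_0 : odd_cos_coef cos 0 = PI / 4.
Proof.
apply is_RInt_unique.
set (F := fun t => t / 2 + sin (2 * t) / 4).
replace (PI / 4) with (minus (F (PI / 2)) (F 0)).
- apply @is_RInt_derive.
  + intros t _; unfold F; auto_derive; auto.
    simpl; rewrite cos_2a_cos, (Rmult_1_l t); field.
  + intros t _; apply continuous_mult_cos.
    apply (ex_derive_continuous cos); auto_derive; auto.
- unfold F, minus, plus, opp; simpl.
  replace (2 * (PI / 2)) with PI by field.
  rewrite Rmult_0_r, sin_PI, sin_0; field.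
Qed.

(** Orthogonality of the odd cosines on the quarter period. *)
Lemma odd_cos_coef_cos_S (n : nat) : odd_cos_coef cos (S n) = 0.
Proof.
assert (Hn := pos_INR n).
apply is_RInt_unique.
set (F := fun t => sin (2 * (INR n + 1) * t) / (4 * (INR n + 1))
                   + sin (2 * (INR n + 2) * t) / (4 * (INR n + 2))).
replace 0 with (minus (F (PI / 2)) (F 0)) at 2.
- apply @is_RInt_derive.
  + intros t _; unfold F; auto_derive; auto.
    rewrite INR_odd, S_INR.
    replace (2 * (INR n + 1) * t) with ((2 * (INR n + 1) + 1) * t - t) by ring.
    replace (2 * (INR n + 2) * t) with ((2 * (INR n + 1) + 1) * t + t) by ring.
    rewrite cos_minus, cos_plus; field; lra.
  + intros t _; apply continuous_mult_cos.
    apply (ex_derive_continuous cos); auto_derive; auto.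
- unfold F, minus, plus, opp; simpl.
  replace (2 * (INR n + 1) * (PI / 2)) with (INR (S n) * PI) by (rewrite S_INR; field).
  replace (2 * (INR n + 2) * (PI / 2)) with (INR (S (S n)) * PI)
    by (rewrite !S_INR; field).
  rewrite !sin_INR_PI, !Rmult_0_r, sin_0; field; lra.
Qed.

Lemma is_series_odd_cos_coef_cos : is_series (odd_cos_coef cos) (PI / 4).
Proof.
change (is_lim_seq (sum_n (odd_cos_coef cos)) (PI / 4)).
apply is_lim_seq_ext with (fun _ => PI / 4); [|apply is_lim_seq_const].
intros N; induction N as [|N IH].
- rewrite sum_O; symmetry; apply odd_cos_coef_cos_0.
- rewrite sum_n_S, <- IH, odd_cos_coef_cos_S; simpl; ring.
Qed.

(** Here the factor sin t cancels the denominator of the Dirichlet kernel exactly,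
so the N-th partial sum is the integral of sin (2 (N + 1) t) / 2. *)
Lemma is_series_odd_cos_coef_sin : is_series (odd_cos_coef sin) 0.
Proof.
set (v := fun N : nat => (1 - cos (INR (N + 1) * PI)) * / (4 * INR (N + 1))).
change (is_lim_seq (sum_n (odd_cos_coef sin)) 0).
apply is_lim_seq_ext with v.
- intros N; symmetry; unfold odd_cos_coef.
  rewrite (sum_RInt (fun n t => sin t * cos (INR (2 * n + 1) * t))).
  2:{ intros n t; apply continuous_mult_cos.
      apply (ex_derive_continuous sin); auto_derive; auto. }
  apply is_RInt_unique.
  assert (HN : INR (N + 1) <> 0) by (apply not_0_INR; lia).
  set (F := fun t => - cos (2 * INR (N + 1) * t) / (4 * INR (N + 1))).
  replace (v N) with (minus (F (PI / 2)) (F 0)).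
  + apply @is_RInt_derive.
    * intros t _; unfold F; auto_derive; auto.
      rewrite (sum_n_mult_l (K := R_Ring) (sin t)).
      assert (E := sum_odd_cos t N); rewrite mult_INR in E; simpl (INR 2) in E.
      replace ((1 + 1) * INR (N + 1)) with (2 * INR (N + 1)) in E by ring.
      set (c := sum_n (G := R_AbelianMonoid) _ N) in E.
      match goal with |- ?l = _ => change (l = sin t * c) end.
      rewrite <- E; field; auto.
    * intros t _; apply (continuous_sum_n (fun n t => sin t * cos (INR (2 * n + 1) * t))).
      intros n; apply continuous_mult_cos.
      apply (ex_derive_continuous sin); auto_derive; auto.
  + unfold F, v, minus, plus, opp; simpl.
    replace (2 * INR (N + 1) * (PI / 2)) with (INR (N + 1) * PI) by field.
    rewrite Rmult_0_r, cos_0; field; auto.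
- assert (Hinv : is_lim_seq (fun N => / (2 * INR (N + 1))) 0).
  { replace (Finite 0) with (Rbar_inv p_infty) by reflexivity.
    apply is_lim_seq_inv; [|discriminate].
    apply is_lim_seq_le_p_loc with INR; [|apply is_lim_seq_INR].
    exists 0%nat; intros N _; rewrite plus_INR; pose proof (pos_INR N); simpl; lra. }
  apply is_lim_seq_le_le with (u := fun _ => 0) (w := fun N => / (2 * INR (N + 1)));
    auto using is_lim_seq_const.
  intros N; unfold v.
  assert (HN : 0 < INR (N + 1)) by (apply lt_0_INR; lia).
  pose proof (COS_bound (INR (N + 1) * PI)).
  assert (0 < / INR (N + 1)) by now apply Rinv_0_lt_compat.
  rewrite !Rinv_mult; nra.
Qed.

Lemma odd_cos_coef_sub_cos_sin (q : R -> R) (c d : R) (n : nat) :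
  (forall t, continuous q t) ->
  odd_cos_coef (fun t => q t - c * cos t - d * sin t) n
  = odd_cos_coef q n - c * odd_cos_coef cos n - d * odd_cos_coef sin n.
Proof.
intros Hq; apply is_RInt_unique.
set (e := fun f : R -> R => fun t => f t * cos (INR (2 * n + 1) * t)).
assert (He : forall f, (forall t, continuous f t) ->
    is_RInt (e f) 0 (PI / 2) (odd_cos_coef f n)).
{ intros f Hf; apply @RInt_correct, @ex_RInt_continuous; intros t _.
  now apply continuous_mult_cos. }
apply (is_RInt_ext
  (fun t => minus (minus (e q t) (scal c (e cos t))) (scal d (e sin t)))).
- intros t _; unfold e, minus, plus, opp, scal; simpl; unfold mult; simpl; ring.
- apply @is_RInt_minus; [apply @is_RInt_minus|]; try apply @is_RInt_scal; apply He; auto;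
    intros t; [apply (ex_derive_continuous cos)|apply (ex_derive_continuous sin)];
    auto_derive; auto.
Qed.

Lemma quadratic_bound (h h1 h2 : R -> R) (b : R) :
  (forall t, is_derive h t (h1 t)) -> (forall t, is_derive h1 t (h2 t)) ->
  (forall t, continuous h2 t) -> h 0 = 0 -> h1 0 = 0 -> 0 <= b ->
  exists K, 0 <= K /\ forall t, 0 <= t <= b -> Rabs (h t) <= K * t ^ 2.
Proof.
intros H0 H1 Hc h0 h10 Hb.
destruct (continuity_ab_maj (fun t => Rabs (h2 t)) 0 b Hb) as [x [Hx _]].
{ intros t _; apply continuity_pt_filterlim.
  apply (continuous_comp h2 Rabs); [apply Hc|apply continuous_Rabs]. }
set (K := Rabs (h2 x)) in Hx.
assert (HK : 0 <= K) by apply Rabs_pos.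
(* One use of the mean value theorem lowers the order of vanishing by one. *)
assert (step : forall (f g : R -> R), (forall t, is_derive f t (g t)) -> f 0 = 0 ->
  forall t, 0 <= t -> exists c, 0 <= c <= t /\ f t = g c * t).
{ intros f g Hf f0 t Ht.
  destruct (MVT_gen f 0 t g) as [c [Hc1 Hc2]].
  - intros; apply Hf.
  - intros y _; apply continuity_pt_filterlim.
    apply (ex_derive_continuous f); eexists; apply Hf.
  - rewrite Rmin_left, Rmax_right in Hc1 by lra.
    exists c; split; [lra|]; rewrite f0 in Hc2; lra. }
exists K; split; auto; intros t Ht.
destruct (step h h1 H0 h0 t) as [c [Hc1 Ec]]; [lra|].
destruct (step h1 h2 H1 h10 c) as [d [Hd Ed]]; [lra|].
rewrite Ec, Ed, !Rabs_mult, (Rabs_pos_eq c), (Rabs_pos_eq t) by lra.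
assert (Hd2 : Rabs (h2 d) <= K) by (apply Hx; lra).
pose proof (Rabs_pos (h2 d)).
assert (Rabs (h2 d) * c <= K * t) by (apply Rmult_le_compat; lra).
simpl; nra.
Qed.

(** Two reference functions are needed: [cos] matches the value of [q] at 0 and
[sin] matches its slope, which leaves a remainder of order t^2. *)
Lemma odd_cos_series (q q1 q2 : R -> R) (l : R) :
  (forall t, is_derive q t (q1 t)) -> (forall t, is_derive q1 t (q2 t)) ->
  (forall t, continuous q2 t) -> is_series (odd_cos_coef q) l -> l = PI / 4 * q 0.
Proof.
intros H0 H1 Hc Hl.
assert (Hq : forall t, continuous q t)
  by (intros t; apply (ex_derive_continuous q); eexists; apply H0).
set (c := q 0); set (d := q1 0).
set (h := fun t => q t - c * cos t - d * sin t).
set (h1 := fun t => q1 t + c * sin t - d * cos t).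
set (h2 := fun t => q2 t + c * cos t + d * sin t).
assert (D0 : forall t, is_derive h t (h1 t)).
{ intros t; unfold h, h1.
  auto_derive; [now eexists; apply H0|].
  rewrite (is_derive_unique (fun x : R => q x) t (q1 t) (H0 t)); ring. }
assert (D1 : forall t, is_derive h1 t (h2 t)).
{ intros t; unfold h1, h2.
  auto_derive; [now eexists; apply H1|].
  rewrite (is_derive_unique (fun x : R => q1 x) t (q2 t) (H1 t)); ring. }
assert (D2 : forall t, continuous h2 t).
{ intros t; unfold h2.
  apply (continuous_plus (fun t => q2 t + c * cos t) (fun t => d * sin t));
    [apply (continuous_plus q2 (fun t => c * cos t)); auto|].
  - apply (ex_derive_continuous (fun t => c * cos t)); auto_derive; auto.
  - apply (ex_derive_continuous (fun t => d * sin t)); auto_derive; auto. }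
assert (HPI := PI_RGT_0).
destruct (quadratic_bound h h1 h2 (PI / 2) D0 D1 D2) as [K [HK Hb]].
{ unfold h, c; rewrite cos_0, sin_0; ring. }
{ unfold h1, d; rewrite cos_0, sin_0; ring. }
{ lra. }
assert (Hz : l - c * (PI / 4) - d * 0 = 0); [|lra].
apply (odd_cos_series_zero h (9 * K)).
- intros t; apply (ex_derive_continuous h); eexists; apply D0.
- intros t Ht; apply Rle_trans with (1 := Hb t Ht).
  pose proof (sin_ge_third t Ht).
  assert (Ht2 : t ^ 2 <= (3 * sin t) ^ 2) by (apply pow_incr; lra).
  pose proof (Rmult_le_compat_l K _ _ HK Ht2); lra.
- apply (is_series_ext (fun n => plus (plus (odd_cos_coef q n)
      (scal (- c) (odd_cos_coef cos n))) (scal (- d) (odd_cos_coef sin n)))).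
  { intros n; unfold h; rewrite odd_cos_coef_sub_cos_sin by auto.
    unfold plus, scal; simpl; unfold mult; simpl; ring. }
  replace (l - c * (PI / 4) - d * 0) with
    (plus (plus l (scal (- c) (PI / 4))) (scal (- d) 0))
    by (unfold plus, scal; simpl; unfold mult; simpl; ring).
  apply @is_series_plus; [apply @is_series_plus; auto|];
    apply @is_series_scal_l;
    [apply is_series_odd_cos_coef_cos|apply is_series_odd_cos_coef_sin].
Qed.

(** * Coefficients of a tower of antiderivatives *)

(** At pi/2 one boundary term vanishes with [q], the other because the frequency
is odd. *)
Lemma odd_cos_coef_by_parts (q q1 q2 : R -> R) (n : nat) :
  (forall t, is_derive q t (q1 t)) -> (forall t, is_derive q1 t (q2 t)) ->
  (forall t, continuous q2 t) -> q (PI / 2) = 0 ->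
  odd_cos_coef q n = - (q1 0 + odd_cos_coef q2 n) * / INR (2 * n + 1) ^ 2.
Proof.
intros H0 H1 Hc Hq.
set (a := INR (2 * n + 1)).
assert (Ha : a <> 0) by (apply not_0_INR; lia).
assert (Hqc : forall t, continuous q t)
  by (intros t; apply (ex_derive_continuous q); eexists; apply H0).
assert (Hcos : cos (a * (PI / 2)) = 0).
{ apply cos_eq_0_1; exists (Z.of_nat n).
  rewrite <- INR_IZR_INZ; unfold a; rewrite INR_odd; field. }
set (F := fun t => q t * sin (a * t) * / a + q1 t * cos (a * t) * / a ^ 2).
assert (E : is_RInt (fun t => q t * cos (a * t) + / a ^ 2 * (q2 t * cos (a * t)))
    0 (PI / 2) (minus (F (PI / 2)) (F 0))).
{ apply @is_RInt_derive.
  - intros t _; unfold F; auto_derive.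
    + repeat split; eexists; [apply H0|apply H1].
    + rewrite (is_derive_unique (fun x : R => q x) t (q1 t) (H0 t)), (is_derive_unique (fun x : R => q1 x) t (q2 t) (H1 t)).
      field; auto.
  - intros t _.
    apply (continuous_plus (fun t => q t * cos (a * t))
             (fun t => / a ^ 2 * (q2 t * cos (a * t)))).
    + now apply continuous_mult_cos.
    + apply (continuous_mult (fun _ => / a ^ 2) (fun t => q2 t * cos (a * t)));
        [apply continuous_const|now apply continuous_mult_cos]. }
assert (E' : is_RInt (fun t => q t * cos (a * t) + / a ^ 2 * (q2 t * cos (a * t)))
    0 (PI / 2) (plus (odd_cos_coef q n) (scal (/ a ^ 2) (odd_cos_coef q2 n)))).
{ apply @is_RInt_plus; [|apply @is_RInt_scal];
    apply @RInt_correct, @ex_RInt_continuous; intros; now apply continuous_mult_cos. }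
apply (is_RInt_unique (V := R_CompleteNormedModule)) in E.
apply (is_RInt_unique (V := R_CompleteNormedModule)) in E'; rewrite E in E'.
unfold F, minus, plus, opp, scal in E'; simpl in E'; unfold mult in E'; simpl in E'.
rewrite Hcos, Hq, !Rmult_0_r, cos_0, sin_0 in E'.
apply (Rplus_eq_reg_r (/ a ^ 2 * odd_cos_coef q2 n)).
simpl; rewrite <- E'; field; auto.
Qed.

(** The real number lambda(2 j + 2); the shift makes every index [j] one of
convergence. *)
Definition lambda_even (j : nat) : R :=
  Series (fun n => / INR (2 * n + 1) ^ (2 * j + 2)).

Lemma is_series_lambda_even (j : nat) :
  is_series (fun n => / INR (2 * n + 1) ^ (2 * j + 2)) (lambda_even j).
Proof.
apply Series_correct.
assert (Hn : forall n, 1 <= INR (2 * n + 1))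
  by (intros n; rewrite INR_odd; pose proof (pos_INR n); lra).
assert (Hsq : ex_series (fun n => / INR (2 * n + 1) ^ 2)).
{ apply (ex_finite_lim_seq_incr (sum_n (fun n => / INR (2 * n + 1) ^ 2)) 2).
  - intros n; rewrite sum_n_S.
    assert (0 < / INR (2 * S n + 1) ^ 2)
      by (apply Rinv_0_lt_compat, pow_lt; specialize (Hn (S n)); lra).
    lra.
  - intros N.
    assert (H : sum_n (fun n => / INR (2 * n + 1) ^ 2) N <= 2 - / INR (2 * N + 1)).
    { induction N as [|N IH].
      - rewrite sum_O; simpl; lra.
      - rewrite sum_n_S.
        specialize (Hn N); rewrite !INR_odd, S_INR in *.
        set (x := INR N) in *.
        (* Telescoping majorant: 1/(2x+3)^2 <= 1/(2x+1) - 1/(2x+3). *)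
        assert (/ (2 * (x + 1) + 1) ^ 2 <= / (2 * x + 1) - / (2 * (x + 1) + 1)).
        { replace (/ (2 * x + 1) - / (2 * (x + 1) + 1))
            with (2 * / ((2 * x + 1) * (2 * (x + 1) + 1))) by (field; lra).
          apply Rle_trans with (/ ((2 * x + 1) * (2 * (x + 1) + 1))).
          - apply Rinv_le_contravar; nra.
          - assert (0 < / ((2 * x + 1) * (2 * (x + 1) + 1)))
              by (apply Rinv_0_lt_compat; nra); lra. }
        lra. }
    assert (0 < / INR (2 * N + 1)) by (apply Rinv_0_lt_compat; specialize (Hn N); lra).
    lra. }
apply @ex_series_le with (2 := Hsq); intros n; specialize (Hn n).
unfold norm; simpl norm; unfold abs; simpl abs.
rewrite Rabs_pos_eq.
- apply Rinv_le_contravar; [apply pow_lt; lra|apply Rle_pow; [lra|lia]].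
- apply Rlt_le, Rinv_0_lt_compat, pow_lt; lra.
Qed.

(** Indexing the functions by degree, so that [w j] is the derivative of
[w (S j)], turns two integrations by parts into the step from [m] to [S m]. *)
Lemma odd_cos_coef_tower (w : nat -> R -> R) (m n : nat) :
  (forall t, is_derive (w 0%nat) t 0) ->
  (forall j t, is_derive (w (S j)) t (w j t)) ->
  (forall k, w (2 * k + 1)%nat (PI / 2) = 0) ->
  (-1) ^ (m + 1) * odd_cos_coef (w (2 * m + 1)%nat) n
  = sum_n (fun k => (-1) ^ k * w (2 * k)%nat 0
             * / INR (2 * n + 1) ^ (2 * (m - k) + 2)) m.
Proof.
intros Hw0 Hw Hmid.
assert (Hc : forall j t, continuous (w (S j)) t)
  by (intros j t; apply (ex_derive_continuous (w (S j))); eexists; apply Hw).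
assert (Ha : INR (2 * n + 1) <> 0) by (apply not_0_INR; lia).
induction m as [|m IH].
- rewrite sum_O; simpl (2 * 0 + 1)%nat.
  rewrite (odd_cos_coef_by_parts (w 1%nat) (w 0%nat) (fun _ => 0));
    auto using continuous_const; [|apply (Hmid 0%nat)].
  assert (E : odd_cos_coef (fun _ => 0) n = 0).
  { unfold odd_cos_coef; rewrite (RInt_ext _ (fun _ => 0)) by (intros; apply Rmult_0_l).
    rewrite RInt_const; unfold scal; simpl; unfold mult; simpl; ring. }
  rewrite E; simpl (2 * 0)%nat; simpl (0 - 0)%nat; simpl (0 + 1)%nat.
  simpl (2 * 0 + 2)%nat; ring.
- rewrite sum_n_S.
  rewrite (odd_cos_coef_by_parts _ (w (2 * S m)%nat) (w (2 * m + 1)%nat)).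
  + rewrite (sum_n_ext_loc _ (fun k => / INR (2 * n + 1) ^ 2 * ((-1) ^ k * w (2 * k)%nat 0
             * / INR (2 * n + 1) ^ (2 * (m - k) + 2)))).
    * rewrite (sum_n_mult_l (K := R_Ring) (/ INR (2 * n + 1) ^ 2)).
      match goal with |- context [@mult R_Ring ?x ?y] =>
        change (@mult R_Ring x y) with (Rmult x y) end.
      change (sum_n (G := Ring.AbelianMonoid R_Ring)) with (sum_n (G := R_AbelianMonoid)).
      rewrite <- IH.
      replace (S m - S m)%nat with 0%nat by lia.
      replace (S m + 1)%nat with (S (m + 1)) by lia.
      replace (S m)%nat with (m + 1)%nat by lia.
      simpl (2 * 0 + 2)%nat; simpl ((-1) ^ S (m + 1)); ring.
    * intros k Hk; replace (2 * (S m - k) + 2)%nat with (2 * (m - k) + 2 + 2)%nat by lia.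
      rewrite pow_add.
      match goal with |- ?l = ?r => change (@eq R l r) end.
      field; auto using pow_nonzero.
  + intros t; replace (2 * S m + 1)%nat with (S (2 * S m)) by lia; apply Hw.
  + intros t; replace (2 * S m)%nat with (S (2 * m + 1)) by lia; apply Hw.
  + intros t; replace (2 * m + 1)%nat with (S (2 * m)) by lia; apply Hc.
  + apply Hmid.
Qed.

Lemma is_series_sum_n (a : nat -> nat -> R) (l : nat -> R) (m : nat) :
  (forall k, is_series (a k) (l k)) ->
  is_series (fun n => sum_n (fun k => a k n) m) (sum_n l m).
Proof.
intros H; induction m as [|m IH].
- rewrite sum_O; apply (is_series_ext (a 0%nat)); auto; intros; now rewrite sum_O.
- rewrite sum_Sn; apply (is_series_ext (fun n => plus (sum_n (fun k => a k n) m) (a (S m) n))).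
  + intros; now rewrite sum_Sn.
  + now apply @is_series_plus.
Qed.

(** Both evaluations of the sum over [n] of the coefficients of [w (2 m + 1)]. *)
Lemma tower_lambda_even (w : nat -> R -> R) (m : nat) :
  (forall t, is_derive (w 0%nat) t 0) ->
  (forall j t, is_derive (w (S j)) t (w j t)) ->
  (forall k, w (2 * k + 1)%nat (PI / 2) = 0) ->
  sum_n (fun k => (-1) ^ k * w (2 * k)%nat 0 * lambda_even (m - k)) m
  = (-1) ^ (m + 1) * (PI / 4 * w (2 * m + 1)%nat 0).
Proof.
intros Hw0 Hw Hmid.
set (s := sum_n _ m).
assert (Hs : is_series (fun n => (-1) ^ (m + 1) * odd_cos_coef (w (2 * m + 1)%nat) n) s).
{ apply (is_series_ext (fun n => sum_n (fun k => (-1) ^ k * w (2 * k)%nat 0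
             * / INR (2 * n + 1) ^ (2 * (m - k) + 2)) m)).
  - intros n; symmetry; now apply odd_cos_coef_tower.
  - apply (is_series_sum_n (fun k n => (-1) ^ k * w (2 * k)%nat 0
             * / INR (2 * n + 1) ^ (2 * (m - k) + 2))).
    intros k; apply @is_series_scal_l, is_series_lambda_even. }
assert (Hsgn : (-1) ^ (m + 1) * (-1) ^ (m + 1) = 1)
  by (rewrite <- Rpow_mult_distr; replace (-1 * -1) with 1 by ring; apply pow1).
assert (Hl : is_series (odd_cos_coef (w (2 * m + 1)%nat)) ((-1) ^ (m + 1) * s)).
{ apply (is_series_ext (fun n => (-1) ^ (m + 1)
      * ((-1) ^ (m + 1) * odd_cos_coef (w (2 * m + 1)%nat) n))).
  - intros n; rewrite <- Rmult_assoc, Hsgn; apply Rmult_1_l.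
  - now apply @is_series_scal_l. }
assert (Hv : (-1) ^ (m + 1) * s = PI / 4 * w (2 * m + 1)%nat 0).
{ replace (2 * m + 1)%nat with (S (2 * m)) in * by lia.
  (* The second derivative is [w (2 m - 1)], or 0 at the bottom of the tower. *)
  assert (exists w2 : R -> R, (forall t, is_derive (w (2 * m)%nat) t (w2 t))
      /\ forall t, continuous w2 t) as [w2 [Hd Hc]].
  { destruct m as [|m].
    - exists (fun _ => 0); split; [apply Hw0|intros; apply continuous_const].
    - replace (2 * S m)%nat with (S (S (2 * m))) by lia.
      exists (w (S (2 * m))); split; [apply Hw|].
      intros t; apply (ex_derive_continuous (w (S (2 * m)))); eexists; apply Hw. }
  apply (odd_cos_series _ (w (2 * m)%nat) w2); auto. }
rewrite <- Hv, <- Rmult_assoc, Hsgn; symmetry; apply Rmult_1_l.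
Qed.

(** * Passage to complex polynomials and to the Dirichlet lambda function *)

Open Scope C_scope.

Lemma Re_shift_mult (b z : C) (t : R) :
  Re ((t + b) * z) = ((t + Re b) * Re z - Im b * Im z)%R.
Proof. unfold Re, Im; simpl; ring. Qed.

Lemma Im_shift_mult (b z : C) (t : R) :
  Im ((t + b) * z) = ((t + Re b) * Im z + Im b * Re z)%R.
Proof. unfold Re, Im; simpl; ring. Qed.

(** Real and imaginary parts have to be treated together, since the product rule
for a power mixes them. *)
Lemma is_derive_Cpow_shift (b : C) (n : nat) (t : R) :
  is_derive (fun t : R => Re ((t + b) ^ S n)) t (INR (S n) * Re ((t + b) ^ n))%R /\
  is_derive (fun t : R => Im ((t + b) ^ S n)) t (INR (S n) * Im ((t + b) ^ n))%R.
Proof.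
induction n as [|n IH].
- split.
  + apply (is_derive_ext (fun t : R => t + Re b)%R); [intros; rewrite Cpow_1_r; unfold Re, Im; simpl; ring|].
    auto_derive; auto; unfold Re, Im; simpl; ring.
  + apply (is_derive_ext (fun t : R => Im b)%R); [intros; rewrite Cpow_1_r; unfold Re, Im; simpl; ring|].
    auto_derive; auto; unfold Re, Im; simpl; ring.
- destruct IH as [IHr IHi].
  set (u := fun t : R => Re ((t + b) ^ S n)) in *.
  set (v := fun t : R => Im ((t + b) ^ S n)) in *.
  assert (Eu : u t = ((t + Re b) * Re ((t + b) ^ n) - Im b * Im ((t + b) ^ n))%R)
    by (unfold u; rewrite Cpow_S; apply Re_shift_mult).
  assert (Ev : v t = ((t + Re b) * Im ((t + b) ^ n) + Im b * Re ((t + b) ^ n))%R)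
    by (unfold v; rewrite Cpow_S; apply Im_shift_mult).
  split.
  + apply (is_derive_ext (fun t => (t + Re b) * u t - Im b * v t)%R).
    { intros s; unfold u, v; rewrite (Cpow_S _ (S n)); symmetry; apply Re_shift_mult. }
    auto_derive; [repeat split; eexists; eassumption|].
    rewrite (is_derive_unique (fun x : R => u x) _ _ IHr),
      (is_derive_unique (fun x : R => v x) _ _ IHi).
    change (Re ((t + b) ^ S n)) with (u t); rewrite Eu, !S_INR; ring.
  + apply (is_derive_ext (fun t => (t + Re b) * v t + Im b * u t)%R).
    { intros s; unfold u, v; rewrite (Cpow_S _ (S n)); symmetry; apply Im_shift_mult. }
    auto_derive; [repeat split; eexists; eassumption|].
    rewrite (is_derive_unique (fun x : R => u x) _ _ IHr),
      (is_derive_unique (fun x : R => v x) _ _ IHi).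
    change (Im ((t + b) ^ S n)) with (v t); rewrite Ev, !S_INR; ring.
Qed.

(** The second shift is chosen so that pi/2 + b and pi/2 - (b + pi) are opposite:
members of odd degree are then odd about pi/2. *)
Definition tower (b : C) (j : nat) (t : R) : C :=
  RtoC (/ INR (fact j)) * ((t + b) ^ j + (t - (b + PI)) ^ j).

Lemma Re_real_mult (r : R) (z : C) : Re (r * z) = (r * Re z)%R.
Proof. unfold Re, Im; simpl; ring. Qed.

Lemma Im_real_mult (r : R) (z : C) : Im (r * z) = (r * Im z)%R.
Proof. unfold Re, Im; simpl; ring. Qed.

Lemma INR_fact_S (j : nat) : (/ INR (fact (S j)) * INR (S j) = / INR (fact j))%R.
Proof.
rewrite fact_simpl, mult_INR; field; split; [apply INR_fact_neq_0|now apply not_0_INR].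
Qed.

Lemma is_derive_tower (b : C) (j : nat) (t : R) :
  is_derive (fun t => Re (tower b (S j) t)) t (Re (tower b j t)) /\
  is_derive (fun t => Im (tower b (S j) t)) t (Im (tower b j t)).
Proof.
destruct (is_derive_Cpow_shift b j t) as [H1 H2].
destruct (is_derive_Cpow_shift (- (b + PI)) j t) as [H3 H4].
unfold tower, Cminus; split.
- rewrite Re_real_mult, <- (INR_fact_S j).
  apply (is_derive_ext (fun t : R => scal (/ INR (fact (S j)))%R
    (plus (Re ((t + b) ^ S j)) (Re ((t + - (b + PI)) ^ S j))))).
  { intros s; rewrite Re_real_mult; reflexivity. }
  replace (/ INR (fact (S j)) * INR (S j) * Re ((t + b) ^ j + (t + - (b + PI)) ^ j))%R
    with (scal (/ INR (fact (S j)))%R (plus (INR (S j) * Re ((t + b) ^ j))%R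
            (INR (S j) * Re ((t + - (b + PI)) ^ j))%R)).
  + apply @is_derive_scal, @is_derive_plus; assumption.
  + replace (Re ((t + b) ^ j + (t + - (b + PI)) ^ j))
      with (Re ((t + b) ^ j) + Re ((t + - (b + PI)) ^ j))%R by reflexivity.
    generalize (/ INR (fact (S j)))%R, (INR (S j)).
    intros; unfold scal, plus; simpl; unfold mult; simpl; ring.
- rewrite Im_real_mult, <- (INR_fact_S j).
  apply (is_derive_ext (fun t : R => scal (/ INR (fact (S j)))%R
    (plus (Im ((t + b) ^ S j)) (Im ((t + - (b + PI)) ^ S j))))).
  { intros s; rewrite Im_real_mult; reflexivity. }
  replace (/ INR (fact (S j)) * INR (S j) * Im ((t + b) ^ j + (t + - (b + PI)) ^ j))%R
    with (scal (/ INR (fact (S j)))%R (plus (INR (S j) * Im ((t + b) ^ j))%R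
            (INR (S j) * Im ((t + - (b + PI)) ^ j))%R)).
  + apply @is_derive_scal, @is_derive_plus; assumption.
  + replace (Im ((t + b) ^ j + (t + - (b + PI)) ^ j))
      with (Im ((t + b) ^ j) + Im ((t + - (b + PI)) ^ j))%R by reflexivity.
    generalize (/ INR (fact (S j)))%R, (INR (S j)).
    intros; unfold scal, plus; simpl; unfold mult; simpl; ring.
Qed.

Lemma Copp_pow_even (z : C) (k : nat) : (- z) ^ (2 * k) = z ^ (2 * k).
Proof. rewrite !Cpow_mult_r; f_equal; simpl; ring. Qed.

Lemma Copp_pow_odd (z : C) (k : nat) : (- z) ^ (2 * k + 1) = - z ^ (2 * k + 1).
Proof. rewrite !Cpow_add_r, Copp_pow_even, !Cpow_1_r; ring. Qed.

Lemma tower_midpoint (b : C) (k : nat) : tower b (2 * k + 1) (PI / 2) = 0.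
Proof.
unfold tower.
replace (RtoC (PI / 2) - (b + PI)) with (- (RtoC (PI / 2) + b)).
- rewrite Copp_pow_odd; ring.
- replace (RtoC PI) with (RtoC (PI / 2) + RtoC (PI / 2))
    by (rewrite <- RtoC_plus; f_equal; field).
  ring.
Qed.

Lemma Re_sum_n (f : nat -> C) (m : nat) : Re (sum_n f m) = sum_n (fun k => Re (f k)) m.
Proof.
induction m as [|m IH]; [now rewrite !sum_O|].
now rewrite !sum_Sn, <- IH.
Qed.

Lemma Im_sum_n (f : nat -> C) (m : nat) : Im (sum_n f m) = sum_n (fun k => Im (f k)) m.
Proof.
induction m as [|m IH]; [now rewrite !sum_O|].
now rewrite !sum_Sn, <- IH.
Qed.

Lemma is_series_RtoC (a : nat -> R) (l : R) :
  is_series a l ->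
  @is_series C_AbsRing C_NormedModule (fun n => RtoC (a n)) (RtoC l).
Proof.
intros H P [eps HP]; unfold filtermap.
assert (HR : locally l (fun x : R => P (RtoC x))).
{ exists eps; intros y Hy; apply HP; split; [exact Hy|apply ball_center]. }
apply (filter_imp (fun n => P (RtoC (sum_n a n)))); [|exact (H _ HR)].
assert (E : forall n, sum_n (G := C_NormedModule) (fun n => RtoC (a n)) n
                      = RtoC (sum_n a n)).
{ intros n; induction n as [|n IH]; [now rewrite !sum_O|].
  rewrite sum_Sn, sum_n_S, IH; symmetry; apply RtoC_plus. }
intros n; rewrite E; auto.
Qed.

Lemma RCpow_pow (x : R) (n : nat) : (0 < x)%R -> RCpow x (RtoC (INR n)) = RtoC (x ^ n).
Proof.
intros Hx; unfold RCpow, Cexp; rewrite <- RtoC_mult; simpl.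
rewrite cos_0, sin_0, Rmult_0_r, Rmult_1_r.
now change (exp (INR n * ln x)) with (Rpower x (INR n)); rewrite Rpower_pow.
Qed.

Lemma dirichlet_lambda_even (j : nat) :
  dirichlet_lambda (RtoC (INR (2 * j + 2))) = RtoC (lambda_even j).
Proof.
apply CSeries_unique.
apply (is_series_ext (fun n => RtoC (/ INR (2 * n + 1) ^ (2 * j + 2))%R)).
- intros n; rewrite RCpow_pow by (apply lt_0_INR; lia).
  rewrite RtoC_inv by (apply pow_nonzero, not_0_INR; lia); unfold Cdiv; symmetry; apply Cmult_1_l.
- apply is_series_RtoC, is_series_lambda_even.
Qed.

Lemma tower_dirichlet_lambda (b : C) (m : nat) :
  sum_n (fun k => (-1) ^ k * tower b (2 * k) 0 * lambda_even (m - k)) m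
  = (-1) ^ (m + 1) * (PI / 4 * tower b (2 * m + 1) 0).
Proof.
assert (Hsgn : forall k, (-1) ^ k = RtoC ((-1) ^ k)%R)
  by (intros; now rewrite RtoC_pow).
assert (E : forall k, (-1) ^ k * tower b (2 * k) 0 * lambda_even (m - k)
    = RtoC ((-1) ^ k * lambda_even (m - k))%R * tower b (2 * k) 0)
  by (intros; rewrite Hsgn, RtoC_mult; ring).
rewrite (sum_n_ext _ _ m E).
replace ((-1) ^ (m + 1) * (PI / 4 * tower b (2 * m + 1) 0))
  with (RtoC ((-1) ^ (m + 1) * (PI / 4))%R * tower b (2 * m + 1) 0)
  by (rewrite Hsgn, RtoC_mult, RtoC_div by lra; ring).
assert (H0 : forall t, tower b 0 t = 2) by (intros t; unfold tower; simpl fact; simpl INR; rewrite Rinv_1; simpl; ring).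
apply injective_projections.
- change (Re (sum_n (fun k => RtoC ((-1) ^ k * lambda_even (m - k))%R * tower b (2 * k) 0) m)
    = Re (RtoC ((-1) ^ (m + 1) * (PI / 4))%R * tower b (2 * m + 1) 0)).
  rewrite Re_sum_n, Re_real_mult, Rmult_assoc.
  rewrite <- (tower_lambda_even (fun j t => Re (tower b j t))).
  + apply sum_n_ext; intros k; rewrite Re_real_mult; simpl; ring.
  + intros t; apply (is_derive_ext (fun _ => 2%R)); [now intros; rewrite H0|apply @is_derive_const].
  + intros j t; apply is_derive_tower.
  + intros k; now rewrite tower_midpoint.
- change (Im (sum_n (fun k => RtoC ((-1) ^ k * lambda_even (m - k))%R * tower b (2 * k) 0) m)
    = Im (RtoC ((-1) ^ (m + 1) * (PI / 4))%R * tower b (2 * m + 1) 0)).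
  rewrite Im_sum_n, Im_real_mult, Rmult_assoc.
  rewrite <- (tower_lambda_even (fun j t => Im (tower b j t))).
  + apply sum_n_ext; intros k; rewrite Im_real_mult; simpl; ring.
  + intros t; apply (is_derive_ext (fun _ => 0%R)); [now intros; rewrite H0|apply @is_derive_const].
  + intros j t; apply is_derive_tower.
  + intros k; now rewrite tower_midpoint.
Qed.

Theorem theorem1p3 (m : nat) (alpha : C) :
  (-1) ^ (m + 1)
    * ((alpha ^ (2 * m + 1) - (alpha - 1) ^ (2 * m + 1)) / 4)
    * (RtoC PI ^ (2 * m + 2) / RtoC (INR (fact (2 * m + 1))))
  + sum_n (fun k : nat =>
      (-1) ^ k
        * (alpha ^ (2 * k) + (alpha - 1) ^ (2 * k))
        * (RtoC PI ^ (2 * k) / RtoC (INR (fact (2 * k))))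
        * dirichlet_lambda (RtoC (INR (2 * m - 2 * k + 2)))) m
  = 0.
Proof.
(* With this [b] the two shifts at t = 0 are (alpha - 1) pi and - alpha pi. *)
set (b := (alpha - 1) * PI).
assert (Hb : b + PI = alpha * PI) by (unfold b; ring).
rewrite (sum_n_ext_loc _ (fun k => (-1) ^ k * tower b (2 * k) 0 * lambda_even (m - k))).
- rewrite tower_dirichlet_lambda; unfold tower.
  rewrite RtoC_inv by apply INR_fact_neq_0.
  rewrite Hb, Cplus_0_l; unfold Cminus; rewrite Cplus_0_l, Copp_pow_odd.
  unfold b; rewrite !Cpow_mult_l.
  replace (2 * m + 2)%nat with (S (2 * m + 1)) by lia; rewrite (Cpow_S PI).
  unfold Cminus, Cdiv; ring.
- intros k Hk; replace (2 * m - 2 * k + 2)%nat with (2 * (m - k) + 2)%nat by lia.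
  rewrite dirichlet_lambda_even; unfold tower.
  rewrite RtoC_inv by apply INR_fact_neq_0.
  rewrite Hb, Cplus_0_l; unfold Cminus; rewrite Cplus_0_l, Copp_pow_even.
  unfold b; rewrite !Cpow_mult_l; unfold Cminus, Cdiv.
  match goal with |- ?l = ?r => change (@eq C l r) end; ring.
Qed.
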